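(* Let $a\ge 1$ and $n\ge 0$ be integers. The number $e^a_n=|E(\Pi^a_n)|$ of edges of the graph $\Pi^a_n$ is $$e^a_n=\sum_{k=0}^n(-1)^{n+k}\left\lceil\frac{n+k}{2}\right\rceil\binom{\left\lfloor\frac{n+k}{2}\right\rfloor}{k}a^k .$$
   Context: For integers $a\ge 1$ and $n\ge 0$, let $\mathcal{S}^a_n$ be the set of all words $\alpha_1\cdots\alpha_n$ of length $n$ over the alphabet $\{0,1,\dots,a\}$ such that the letter $a$ appears only immediately after a letter $0$ (so $\alpha_1\ne a$, and $\alpha_i=a$ implies $\alpha_{i-1}=0$). The metallic cube $\Pi^a_n$ is the simple graph with vertex set $\mathcal{S}^a_n$ in which two vertices $\alpha,\beta$ are adjacent if and only if $\sum_{k=1}^n|\alpha_k-\beta_k|=1$, i.e. one is obtained from the other by replacing a single letter $k$ by $k+1$, $0\le k\le a-1$. ($\Pi^a_0$ has a single vertex and no edges.) *)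

(* Defs.v *)
From HB Require Import structures.
From mathcomp Require Import all_boot all_order all_algebra.

Set Implicit Arguments.
Unset Strict Implicit.
Unset Printing Implicit Defensive.

Import Order.TTheory GRing.Theory Num.Theory.

Section SimpleGraph.
Variable (V : finType) (adj : rel V).

(* Edges are unordered: each edge is the two-element set of its endpoints,
   for a symmetric irreflexive [adj]. *)
Definition edge_set : {set {set V}} :=
  [set [set p.1; p.2] | p : V * V & adj p.1 p.2].

End SimpleGraph.

Section MetallicCube.
Variables a n : nat.

(* No index [j] satisfies [j.+1 = 0], so the first letter is never [a]. *)
Definition metallic_word (w : n.-tuple 'I_a.+1) : bool :=
  [forall i : 'I_n, (tnth w i == a :> nat) ==>
     [exists j : 'I_n, (j.+1 == i :> nat) && (tnth w j == 0 :> nat)]].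

Definition metallic_vertex := {w : n.-tuple 'I_a.+1 | metallic_word w}.

(* The subtraction under [`|_ - _|] is that of integers, not truncated. *)
Definition metallic_adj : rel metallic_vertex := fun u v =>
  \sum_(k < n) `|tnth (val u) k - tnth (val v) k| == 1.

Lemma metallic_adj_sym : symmetric metallic_adj.
Proof.
move=> u v; congr (_ == _); apply: eq_bigr => k _.
by rewrite distnC.
Qed.

Lemma metallic_adj_irr : irreflexive metallic_adj.
Proof.
by move=> u; rewrite /metallic_adj big1 // => k _; rewrite distnn.
Qed.

Definition metallic_edges : {set {set metallic_vertex}} :=
  edge_set metallic_adj.

End MetallicCube.

(* Main.v *)
Require Import Defs.
From mathcomp Require Import all_boot all_order all_algebra.
From mathcomp Require Import zify ring.
Import GRing.Theory Num.Theory.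
Local Open Scope ring_scope.

(** Summing over ordered pairs of vertices is easier than over edges, so the
    proof counts ordered adjacent pairs; each edge gives two of them
    ([card_adj_pairs]).

    Whether a word may follow a given prefix depends only on the last letter of
    the prefix, in fact only on whether that letter is [0].  So both the words
    and the adjacent pairs are counted after an arbitrary preceding letter [x];
    the words of the cube are those after [1], a letter that forbids [a] just as
    an empty prefix does.  Peeling off the first letters [y] and [z] of two
    words at distance 1 leaves two cases: either [y = z] and the remaining words
    are adjacent, or [y] and [z] are consecutive and the remaining words are
    equal, in which case, as one of [y] and [z] is nonzero, their common value
    is a word after [1] ([count_adj_pairsS]).  Eliminating the counts after [0]
    gives, for the numbers [s n] of vertices and [e n] of edges,

      [s (n+2) = a s (n+1) + s n],
      [e (n+2) = a (e (n+1) + s (n+1)) + e n + s n - s (n+1)].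

    On the other side, the right-hand side of the theorem has the form
    [sum_k c (n + k) k * a ^ k], and so has the expected closed form of [s n],
    where [c m k] is [C(m/2,k)] for [m] even and [0] for [m] odd.  In the
    variables [m = n + k] and [k], the two recurrences become identities between
    single coefficients, separately for each parity of [m], and these follow
    from Pascal's rule ([word_coefSS], [edge_coefSS]).  The values
    at [n = 0] and [n = 1] agree as well. *)

(** * Ordered adjacent pairs and edges *)

Section Handshake.
Local Open Scope nat_scope.
#[local] Set Implicit Arguments.
#[local] Unset Strict Implicit.
Variables (V : finType) (adj : rel V).

Lemma card_edge_fiber (u v : V) :
  symmetric adj -> irreflexive adj -> adj u v ->
  \sum_(p : V * V | adj p.1 p.2 && ([set p.1; p.2] == [set u; v])) 1 = 2.
Proof.
move=> adjC adjI uv.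
have neq_uv : u != v by apply: contraTneq uv => ->; rewrite adjI.
rewrite -(_ : #|[set (u, v); (v, u)]| = 2); last first.
  by rewrite cards2 xpair_eqE negb_and neq_uv.
rewrite -sum1_card; apply: eq_bigl => -[x y]; rewrite !inE !xpair_eqE /=.
apply/andP/orP => [[xy /eqP/setP E]|[]/andP[/eqP-> /eqP->]]; last first.
- by rewrite adjC setUC.
- by [].
have neq_xy : x != y by apply: contraTneq xy => ->; rewrite adjI.
have := E x; have := E y; rewrite !inE !eqxx orbT /= => /esym/orP Ey.
move=> /esym/orP Ex.
case: Ex Ey => /eqP Ex [] /eqP Ey; rewrite Ex Ey ?eqxx in neq_xy *;
  by [|left|right].
Qed.

(** The map from ordered adjacent pairs onto edges has all its fibers of size
    2, by the preceding lemma. *)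
Lemma card_adj_pairs :
  symmetric adj -> irreflexive adj ->
  \sum_(u : V) \sum_(v : V) adj u v = 2 * #|edge_set adj|.
Proof.
move=> adjC adjI.
rewrite pair_big /=.
transitivity (\sum_(p in [set q : V * V | adj q.1 q.2]) 1).
  rewrite [RHS]big_mkcond; apply: eq_bigr => p _; rewrite inE.
  by case: (adj _ _).
rewrite (partition_big_imset (fun p : V * V => [set p.1; p.2])) /=.
have -> : [set [set p.1; p.2] | p in [set q : V * V | adj q.1 q.2]] =
          edge_set adj.
  by apply: eq_imset.
rewrite mulnC -sum_nat_const; apply: eq_bigr => e /imsetP[[u v] uv ->].
rewrite inE in uv.
rewrite -(card_edge_fiber adjC adjI uv); apply: eq_bigl => p.
by rewrite inE.
Qed.
End Handshake.

(** * Counting words and adjacent pairs by their first letters *)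

Section Words.
Local Open Scope nat_scope.
#[local] Set Implicit Arguments.
#[local] Unset Strict Implicit.

Lemma sum_tuple_cons (T : finType) n (F : n.+1.-tuple T -> nat) :
  \sum_(w : n.+1.-tuple T) F w =
  \sum_(x : T) \sum_(w : n.-tuple T) F (cons_tuple x w).
Proof.
rewrite pair_big /=.
rewrite (reindex (fun p : T * n.-tuple T => cons_tuple p.1 p.2)) //=.
exists (fun w => (thead w, behead_tuple w)) => [[x w]|w] _ /=.
  by congr (_, _); apply: val_inj.
by apply: val_inj; case/tupleP: w.
Qed.

Lemma sum_tuple0 (T : finType) (F : 0.-tuple T -> nat) :
  \sum_(w : 0.-tuple T) F w = F [tuple].
Proof.
by rewrite (big_pred1 [tuple]) // => w; apply/esym/eqP; apply: tuple0.
Qed.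

Variable a : nat.

(** Only the restriction on the letter [a] is recorded: the other bounds on [y]
    come from the type of letters. *)
Definition follows (x y : nat) : bool := (y == a) ==> (x == 0).

Definition word_after (x n : nat) (w : n.-tuple 'I_a.+1) : bool :=
  path follows x (map val w).

Definition l1dist (n : nat) (u v : n.-tuple 'I_a.+1) : nat :=
  \sum_(k < n) `|tnth u k - tnth v k|.

Lemma l1dist_cons n y z (u v : n.-tuple 'I_a.+1) :
  l1dist (cons_tuple y u) (cons_tuple z v) = `|y - z| + l1dist u v.
Proof.
rewrite /l1dist big_ord_recl; congr (_ + _).
by apply: eq_bigr => k _; rewrite !(tnth_nth ord0).
Qed.

Lemma l1dist_eq0 n (u v : n.-tuple 'I_a.+1) : (l1dist u v == 0) = (u == v).
Proof.
rewrite sum_nat_eq0; apply/forallP/eqP => [eq_uv|-> k]; last by rewrite distnn.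
by apply: eq_from_tnth => k; apply/val_inj/eqP;
  rewrite -distn_eq0; apply: eq_uv.
Qed.

(** The preceding letter [1] stands for the empty prefix: like the start of a
    word, it is not a [0]. *)
Lemma metallic_word_after n (w : n.-tuple 'I_a.+1) :
  metallic_word w = word_after 1 w.
Proof.
apply/forallP/(pathP 0) => [ok i|ok i].
  rewrite size_map size_tuple => lt_in; apply/implyP => wi_a.
  have /implyP/(_ _)/existsP[|j /andP[/eqP ij wj0]] := ok (Ordinal lt_in).
    by move: wi_a; rewrite (nth_map ord0) ?size_tuple // (tnth_nth ord0).
  move: ij wj0 => /= <- /=; rewrite (nth_map ord0) ?size_tuple //.
  by rewrite (tnth_nth ord0).
apply/implyP => wi_a; apply/existsP.
have := ok i; rewrite size_map size_tuple => /(_ (ltn_ord i)) /implyP.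
rewrite (nth_map ord0) ?size_tuple // -tnth_nth => /(_ wi_a).
case Ei: (val i) => [//|j] /=.
have lt_jn : j < n by apply: ltnW; rewrite -Ei; apply: ltn_ord.
rewrite (nth_map ord0) ?size_tuple // => wj0.
by exists (Ordinal lt_jn); rewrite eqxx (tnth_nth ord0).
Qed.

Definition count_words x n := \sum_(w : n.-tuple 'I_a.+1) word_after x w.

Definition count_adj_pairs x n :=
  \sum_(u : n.-tuple 'I_a.+1) \sum_(v : n.-tuple 'I_a.+1)
    [&& word_after x u, word_after x v & l1dist u v == 1].

Lemma card_metallic_edges n : 2 * #|metallic_edges a n| = count_adj_pairs 1 n.
Proof.
rewrite -(card_adj_pairs (@metallic_adj_sym a n) (@metallic_adj_irr a n)).
pose W := [pred w : n.-tuple 'I_a.+1 | metallic_word w].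
have sum_W (F : n.-tuple 'I_a.+1 -> nat) :
    \sum_(w : metallic_vertex a n) F (val w) = \sum_w word_after 1 w * F w.
  rewrite -(big_sub W) big_mkcond; apply: eq_bigr => w _.
  by rewrite inE metallic_word_after; case: word_after; rewrite ?mul1n ?mul0n.
pose H u := \sum_(v : metallic_vertex a n) (l1dist u (val v) == 1 : nat).
rewrite (sum_W H); apply: eq_bigr => u _.
rewrite /H (sum_W (fun v => l1dist u v == 1 : nat)) big_distrr.
apply: eq_bigr => v _.
by rewrite /= !mulnb.
Qed.

Lemma count_words0 x : count_words x 0 = 1.
Proof. by rewrite /count_words sum_tuple0. Qed.

Lemma count_adj_pairs0 x : count_adj_pairs x 0 = 0.
Proof. by rewrite /count_adj_pairs !sum_tuple0 /l1dist big_ord0 !andbF. Qed.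

(** The letters allowed after [x] are an initial segment, so they are given by
    their number. *)
Definition letters x := a + (x == 0).

Lemma sum_follows x (f : nat -> nat) :
  \sum_(y < a.+1) follows x y * f y = \sum_(y < letters x) f y.
Proof.
rewrite big_ord_recr /= /letters /follows eqxx /=.
have -> : \sum_(y < a) ((y == a :> nat) ==> (x == 0)) * f y = \sum_(y < a) f y.
  by apply: eq_bigr => y _; rewrite ltn_eqF ?mul1n.
by case: eqP => _; rewrite ?mul0n ?addn0 // addn1 big_ord_recr mul1n.
Qed.

Lemma word_after_cons x y n (w : n.-tuple 'I_a.+1) :
  word_after x (cons_tuple y w) = follows x y && word_after y w.
Proof. by []. Qed.

Lemma word_afterS x y n (w : n.-tuple 'I_a.+1) :
  word_after x.+1 w = word_after y.+1 w.
Proof. by rewrite /word_after; case: (map _ _). Qed.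

Lemma count_wordsS x n : 0 < a ->
  count_words x n.+1 =
  count_words 0 n + (letters x).-1 * count_words 1 n.
Proof.
move=> a_gt0; rewrite /count_words sum_tuple_cons.
under eq_bigr => y _ do under eq_bigr => w _ do rewrite word_after_cons -mulnb.
under eq_bigr => y _ do rewrite -big_distrr.
rewrite (sum_follows x (count_words^~ n)).
rewrite -[letters x]prednK ?addn_gt0 ?a_gt0 // big_ord_recl; congr (_ + _).
rewrite -[in RHS](card_ord (letters x).-1) -sum_nat_const.
by apply: eq_bigr => y _; apply: eq_bigr => w _; congr nat_of_bool;
  apply: word_afterS.
Qed.

Lemma word_after0 x n (w : n.-tuple 'I_a.+1) : word_after x w -> word_after 0 w.
Proof.
rewrite /word_after; case: (map _ _) => //= y s /andP[_ ->].
by rewrite /follows implybT.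
Qed.

(** One of two consecutive letters is nonzero, and the condition it puts on
    the rest of the word is the stronger one. *)
Lemma word_after_dist1 (y z n : nat) (w : n.-tuple 'I_a.+1) :
  `|y - z| == 1 -> word_after y w && word_after z w = word_after 1 w.
Proof.
case: y z => [|y] [|z] yz; first by rewrite distnn in yz.
- rewrite (word_afterS z 0); apply: andb_idl; exact: word_after0.
- rewrite (word_afterS y 0); apply: andb_idr; exact: word_after0.
- by rewrite (word_afterS y 0) (word_afterS z 0) andbb.
Qed.

Lemma sum_dist1 m : \sum_(y < m.+1) \sum_(z < m.+1) (`|y - z| == 1) = 2 * m.
Proof.
have last_row k : \sum_(z < k) (`|k - z| == 1) = (0 < k).
  case: k => [|k]; first by rewrite big_ord0.
  rewrite big_ord_recr big1 /= ?distSn // => z _.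
  by rewrite distnEl ?leqW 1?ltnW // subSn 1?ltnW // eqSS
             subn_eq0 leqNgt ltn_ord.
elim: m => [|m IHm]; first by rewrite !big_ord_recr !big_ord0.
rewrite big_ord_recr /=.
under eq_bigr => y _ do rewrite big_ord_recr /=.
rewrite big_split /= IHm [X in _ + X]big_ord_recr /= distnn addn0 last_row.
under eq_bigr => y _ do rewrite distnC.
by rewrite last_row -addnA mulnS addnC.
Qed.

(** A distance of 1 is spent either in the first letters or in the remaining
    words; the two summands correspond to these cases. *)
Lemma count_adj_pairs_cons (y z n : nat) :
  \sum_(u : n.-tuple 'I_a.+1) \sum_(v : n.-tuple 'I_a.+1)
    [&& word_after y u, word_after z v & `|y - z| + l1dist u v == 1] =
  (y == z) * count_adj_pairs y n + (`|y - z| == 1) * count_words 1 n.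
Proof.
have [<-|neq_yz] := eqVneq y z; first by rewrite distnn mul1n mul0n addn0.
rewrite mul0n add0n big_distrr; apply: eq_bigr => u _ /=.
rewrite (bigD1 u) //= big1 ?addn0 => [|v neq_vu].
  have /eqP-> : l1dist u u == 0 by rewrite l1dist_eq0.
  rewrite addn0 mulnb andbA; case: (boolP (_ == 1)) => [yz|_].
    by rewrite andbT word_after_dist1.
  by rewrite andbF.
have : l1dist u v != 0 by rewrite l1dist_eq0 eq_sym.
have : `|y - z| != 0 by rewrite distn_eq0.
case: `|y - z| => // d _; case: (l1dist u v) => // e _.
by rewrite addSn addnS !andbF.
Qed.

(** Among the first letters allowed after [x], one is [0] and all the others
    act like [1], whence the first two summands; the last one counts the pairs
    of consecutive first letters, each with a common remainder. *)
Lemma count_adj_pairsS x n : 0 < a ->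
  count_adj_pairs x n.+1 =
  count_adj_pairs 0 n + (letters x).-1 * count_adj_pairs 1 n
  + 2 * (letters x).-1 * count_words 1 n.
Proof.
move=> a_gt0.
pose K (y z : nat) := (y == z) * count_adj_pairs y n
                       + (`|y - z| == 1) * count_words 1 n.
transitivity (\sum_(y < a.+1) follows x y *
                \sum_(z < a.+1) follows x z * K y z).
  rewrite {1}/count_adj_pairs sum_tuple_cons; apply: eq_bigr => y _.
  under eq_bigr => u _ do rewrite sum_tuple_cons.
  rewrite exchange_big big_distrr; apply: eq_bigr => z _ /=.
  rewrite /K -count_adj_pairs_cons !big_distrr; apply: eq_bigr => u _.
  rewrite !big_distrr; apply: eq_bigr => v _ /=.
  rewrite !word_after_cons l1dist_cons !mulnb; congr nat_of_bool.
  by rewrite -!andbA; do !bool_congr.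
rewrite (sum_follows x (fun y => \sum_(z < a.+1) follows x z * K y z)).
under eq_bigr => y _ do rewrite (sum_follows x (K y)).
have -> : letters x = (letters x).-1.+1.
  by rewrite prednK // addn_gt0 a_gt0.
move: (letters x).-1 => m /=.
transitivity (\sum_(y < m.+1) (count_adj_pairs y n +
                (\sum_(z < m.+1) (`|y - z| == 1)) * count_words 1 n)).
  apply: eq_bigr => y _; rewrite big_split /= -!big_distrl /=; congr (_ + _).
  rewrite (bigD1 y) //= eqxx big1 ?addn0 ?mul1n // => z neq_zy.
  by rewrite eq_sym -[_ == _]/(z == y) (negPf neq_zy).
rewrite big_split /= -big_distrl /= sum_dist1; congr (_ + _).
rewrite big_ord_recl; congr (_ + _).
rewrite -[in RHS](card_ord m) -sum_nat_const; apply: eq_bigr => y _.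
apply: eq_bigr => u _; apply: eq_bigr => v _.
by rewrite (word_afterS _ 0 u) (word_afterS _ 0 v).
Qed.

End Words.

(** * The closed forms and their recurrences *)

Section Diagonal.
#[local] Set Implicit Arguments.
#[local] Unset Strict Implicit.
Variables (R : comNzRingType) (x : R).

(** The truncation [N] is independent of [n], so that sums along neighbouring
    diagonals can be combined term by term; any [N] larger than [n] gives the
    same value for the coefficients below ([diagonal_sum_trunc]). *)
Definition diagonal_sum (N : nat) (c : nat -> nat -> R) (n : nat) : R :=
  \sum_(0 <= k < N) c (n + k)%N k * x ^+ k.

Lemma diagonal_sumD N c d n :
  diagonal_sum N (fun m k => c m k + d m k) n =
  diagonal_sum N c n + diagonal_sum N d n.
Proof.
by rewrite -big_split; apply: eq_bigr => k _; rewrite mulrDl.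
Qed.

Lemma diagonal_sumB N c d n :
  diagonal_sum N (fun m k => c m k - d m k) n =
  diagonal_sum N c n - diagonal_sum N d n.
Proof.
by rewrite -sumrB; apply: eq_bigr => k _; rewrite mulrBl.
Qed.

(** This turns a recurrence between coefficients into one between diagonal
    sums.  Multiplication by [x] moves the index [k] to [k + 1], so [p] is
    summed with one term less, along the diagonal between those of [c] and
    [q]. *)
Lemma diagonal_sumSS N c p q n :
  (forall m, c m.+2 0 = q m 0) ->
  (forall m k, c m.+2 k.+1 = p m k + q m k.+1) ->
  diagonal_sum N.+1 c n.+2 = x * diagonal_sum N p n.+1 + diagonal_sum N.+1 q n.
Proof.
move=> c0 cS; rewrite /diagonal_sum [LHS]big_nat_recl //.
rewrite [in RHS]big_nat_recl //.
rewrite !addSn c0 [RHS]addrCA big_distrr -big_split /=; congr (_ + _).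
apply: eq_bigr => k _; rewrite !addSn cS addnS mulrDl; congr (_ + _).
by rewrite exprS mulrCA.
Qed.

(** For [k] larger than [n], half of [n + k] is smaller than [k]. *)
Lemma diagonal_sum_trunc N c n :
  (forall m k, (m./2 < k)%N -> c m k = 0) -> (n < N)%N ->
  diagonal_sum N c n = diagonal_sum n.+1 c n.
Proof.
move=> c0 ltnN; rewrite /diagonal_sum (big_cat_nat _ (n := n.+1)) //=.
rewrite [X in _ + X]big_nat_cond [X in _ + X]big1 ?addr0 // => k.
rewrite andbT => /andP[lt_nk _].
by rewrite c0 ?mul0r // ltn_half_double -addnn ltn_add2r.
Qed.

Definition word_coef (m k : nat) : R := if odd m then 0 else 'C(m./2, k)%:R.

Definition edge_coef (m k : nat) : R :=
  (-1) ^+ m * (uphalf m)%:R * 'C(m./2, k)%:R.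

Lemma word_coef_small m k : (m./2 < k)%N -> word_coef m k = 0.
Proof. by move=> lt_mk; rewrite /word_coef bin_small // if_same. Qed.

Lemma edge_coef_small m k : (m./2 < k)%N -> edge_coef m k = 0.
Proof. by move=> lt_mk; rewrite /edge_coef bin_small // mulr0. Qed.

Lemma word_coefSS0 m : word_coef m.+2 0 = word_coef m 0.
Proof. by rewrite /word_coef /= negbK !bin0. Qed.

Lemma word_coefSS m k :
  word_coef m.+2 k.+1 = word_coef m k + word_coef m k.+1.
Proof.
rewrite /word_coef /= negbK binS; case: ifP => _; first by rewrite addr0.
by rewrite natrD addrC.
Qed.

Lemma edge_coefE m k :
  edge_coef m k = (if odd m then - (m./2.+1)%:R else m./2%:R) * 'C(m./2, k)%:R.
Proof.
rewrite /edge_coef -signr_odd uphalf_half; case: odd => /=.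
  by rewrite expr1 mulN1r.
by rewrite expr0 mul1r.
Qed.

(** The instance of [edge_coefSS] at index [0], where the coefficients of index
    [-1] vanish. *)
Lemma edge_coefSS0 m :
  edge_coef m.+2 0 = edge_coef m 0 + word_coef m 0 - word_coef m.+1 0.
Proof.
rewrite !edge_coefE /word_coef /= negbK !bin0 !mulr1 -!natr1.
case: (odd m) => /=; ring.
Qed.

(** With [j] half of [m], rounded down, this says
    [(j+1) C(j+1,k+1) = (j+1) (C(j,k) + C(j,k+1))] for [m] even, and
    [- (j+2) C(j+1,k+1) = - (j+1) (C(j,k) + C(j,k+1)) - C(j+1,k+1)] for [m]
    odd. *)
Lemma edge_coefSS m k :
  edge_coef m.+2 k.+1 =
  (edge_coef m k + word_coef m k) +
  (edge_coef m k.+1 + word_coef m k.+1 - word_coef m.+1 k.+1).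
Proof.
rewrite !edge_coefE /word_coef /= uphalf_half negbK binS natrD -!natr1.
case: (odd m) => /=; rewrite ?add1n ?binS ?natrD; ring.
Qed.

Definition word_poly n := diagonal_sum n.+1 word_coef n.
Definition edge_poly n := diagonal_sum n.+1 edge_coef n.

Lemma word_polySS n : word_poly n.+2 = x * word_poly n.+1 + word_poly n.
Proof.
rewrite {1}/word_poly.
rewrite (@diagonal_sumSS _ _ _ _ _ word_coefSS0 word_coefSS); congr (_ + _).
by apply: (diagonal_sum_trunc word_coef_small); rewrite ltnW.
Qed.

Lemma edge_polySS n :
  edge_poly n.+2 =
  x * (edge_poly n.+1 + word_poly n.+1) +
  (edge_poly n + word_poly n - word_poly n.+1).
Proof.
rewrite {1}/edge_poly.
(* The last term of [q], summed along diagonal [n], is [word_coef] summed along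
   diagonal [n.+1]. *)
pose q m k := edge_coef m k + word_coef m k - word_coef m.+1 k.
have -> := @diagonal_sumSS n.+2 _ _ q n edge_coefSS0 edge_coefSS.
rewrite diagonal_sumD diagonal_sumB diagonal_sumD.
have -> : diagonal_sum n.+3 (fun m k => word_coef m.+1 k) n =
          diagonal_sum n.+3 word_coef n.+1 by [].
by rewrite ?(diagonal_sum_trunc edge_coef_small)
           ?(diagonal_sum_trunc word_coef_small) //; lia.
Qed.

Lemma word_poly0 : word_poly 0 = 1.
Proof. by rewrite /word_poly /diagonal_sum big_nat1 /word_coef /= mulr1. Qed.

Lemma word_poly1 : word_poly 1 = x.
Proof.
rewrite /word_poly /diagonal_sum !big_nat_recr //= big_geq //.
by rewrite /word_coef /= mul0r !add0r mul1r.
Qed.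

Lemma edge_poly0 : edge_poly 0 = 0.
Proof. by rewrite /edge_poly /diagonal_sum big_nat1 edge_coefE /= !mul0r. Qed.

Lemma edge_poly1 : edge_poly 1 = x - 1.
Proof.
rewrite /edge_poly /diagonal_sum !big_nat_recr //= big_geq //.
by rewrite !edge_coefE /= !binn ?bin0; ring.
Qed.

End Diagonal.

(** * Comparison of the counts with the closed forms *)

Section Count.
Variables (a : nat) (a_gt0 : (0 < a)%N).

Lemma count_words_poly n : (count_words a 1 n)%:Z = word_poly a%:Z n.
Proof.
have rec m :
    (count_words a 1 m.+2 = a * count_words a 1 m.+1 + count_words a 1 m)%N.
  rewrite !count_wordsS // /letters /=; nia.
suff : (count_words a 1 n)%:Z = word_poly a%:Z n /\
       (count_words a 1 n.+1)%:Z = word_poly a%:Z n.+1 by case.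
elim: n => [|n [IH0 IH1]]; split=> //.
- by rewrite count_words0 word_poly0.
- rewrite count_wordsS // !count_words0 word_poly1 /letters /=; lia.
- by rewrite rec word_polySS PoszD PoszM IH0 IH1.
Qed.

Lemma count_adj_pairs_poly n :
  (count_adj_pairs a 1 n)%:Z = 2 * edge_poly a%:Z n.
Proof.
have rec m : (count_adj_pairs a 1 m.+2 + 2 * count_words a 1 m.+1 =
    a * (count_adj_pairs a 1 m.+1 + 2 * count_words a 1 m.+1)
      + (count_adj_pairs a 1 m + 2 * count_words a 1 m))%N.
  rewrite !(count_wordsS, count_adj_pairsS) // /letters /=; nia.
suff : (count_adj_pairs a 1 n)%:Z = 2 * edge_poly a%:Z n /\
       (count_adj_pairs a 1 n.+1)%:Z = 2 * edge_poly a%:Z n.+1 by case.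
elim: n => [|n [IH0 IH1]]; split=> //.
- by rewrite count_adj_pairs0 edge_poly0.
- rewrite count_adj_pairsS // !count_adj_pairs0 !count_words0 edge_poly1.
  rewrite /letters /=; lia.
rewrite edge_polySS -!count_words_poly.
have := rec n; lia.
Qed.

End Count.

Theorem theorem8 (a n : nat) (ha : (1 <= a)%N) :
  #|metallic_edges a n|%:Z =
  \sum_(0 <= k < n.+1)
     (-1) ^+ (n + k) * (uphalf (n + k))%:Z * 'C((n + k)./2, k)%:Z * a%:Z ^+ k.
Proof.
have := count_adj_pairs_poly a ha n.
rewrite -card_metallic_edges PoszM => /mulfI-> //.
by apply: eq_bigr => k _; rewrite /edge_coef !natz.
Qed.
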